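(* Let $k,k'\ge 3$, let $G=(V\cup\{m\},E)$ be a $k$-prn-irreducible comparability graph and $G'=(V'\cup\{m'\},E')$ a $k'$-prn-irreducible comparability graph, with disjoint vertex sets. If $G\ast G'$ is a comparability graph, then $\mathcal{R}^p(G\ast G')=\max\{k,k'\}$.
   Context: All graphs are finite, simple and connected. A comparability graph is a graph admitting a transitive orientation. Comparability graphs are exactly the graphs represented by a concatenation of permutations of their vertex set (a word represents a graph if distinct vertices are adjacent iff their occurrences in the word alternate, i.e., form $abab\cdots$ or $baba\cdots$); $\mathcal{R}^p(C)$ is the least number of permutations needed. For $k\ge 2$, a comparability graph $C=(W,F)$ is $k$-prn-irreducible if $\mathcal{R}^p(C)=k$ and $\mathcal{R}^p(C[W\setminus\{a\}])=k-1$ for every $a\in W$. Split recomposition: $G\ast G'$ has vertex set $V\cup V'$ and edges: those of $G[V]$, those of $G'[V']$, and all $\overline{ab}$ with $a\in N_G(m)$, $b\in N_{G'}(m')$. *)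

(* Defs.v *)
From HB Require Import structures.
From mathcomp Require Import all_boot.

Set Implicit Arguments.
Unset Strict Implicit.
Unset Printing Implicit Defensive.

Record sgraph := SGraph {
  vertex :> finType;
  adj : rel vertex;
  adj_sym : symmetric adj;
  adj_irrefl : irreflexive adj
}.

Definition nbhd (G : sgraph) (x : G) : {set G} := [set y | adj x y].

Definition connected (G : sgraph) : Prop := forall x y : G, connect (@adj G) x y.

Section Induced.
Variables (G : sgraph) (A : {set G}).

Definition induced_adj : rel {x : G | x \in A} :=
  fun x y => adj (val x) (val y).

Lemma induced_sym : symmetric induced_adj.
Proof. by move=> x y; exact: adj_sym. Qed.

Lemma induced_irrefl : irreflexive induced_adj.
Proof. by move=> x; exact: adj_irrefl. Qed.

Definition induced : sgraph := SGraph induced_sym induced_irrefl.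
End Induced.

Section Comparability.
Variable G : sgraph.

Definition is_orientation (r : rel G) : Prop :=
  (forall x y, adj x y = r x y || r y x) /\
  (forall x y, ~~ (r x y && r y x)).

Definition comparability_graph : Prop :=
  exists r : rel G, is_orientation r /\ transitive r.
End Comparability.

Section WordRepresentation.
Variable G : sgraph.

Definition alternate (x y : G) (w : seq G) : bool :=
  sorted (fun a b => a != b) [seq z <- w | pred2 x y z].

(* Every vertex must occur in the word; otherwise the empty word would
   represent every complete graph. *)
Definition represents (w : seq G) : Prop :=
  (forall x : G, x \in w) /\
  (forall x y : G, x != y -> adj x y = alternate x y w).

Definition perm_representable (k : nat) : Prop :=
  exists ps : seq (seq G),
    [/\ size ps = k,
        forall p, p \in ps -> perm_eq p (enum G) &
        represents (flatten ps)].

(* The relational form of R^p(G) = k: a graph that is not a comparability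
   graph has no such k. *)
Definition is_prn (k : nat) : Prop :=
  perm_representable k /\ (forall j, perm_representable j -> k <= j).
End WordRepresentation.

Definition prn_irreducible (k : nat) (G : sgraph) : Prop :=
  [/\ 2 <= k, comparability_graph G, is_prn G k &
      forall a : G, is_prn (induced [set~ a]) k.-1].

Section SplitRecomposition.
Variables (G G' : sgraph) (m : G) (m' : G').

(* The vertex sets V = [set~ m] and V' = [set~ m'] are made disjoint by the
   sum type. *)
Definition split_vertex : finType :=
  (induced [set~ m] + induced [set~ m'])%type.

Definition split_adj : rel split_vertex := fun u v =>
  match u, v with
  | inl a, inl b => adj a b
  | inr a, inr b => adj a b
  | inl a, inr b | inr b, inl a => (val a \in nbhd m) && (val b \in nbhd m')
  end.

Lemma split_sym : symmetric split_adj.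
Proof. by move=> [a|a] [b|b] //=; exact: induced_sym. Qed.

Lemma split_irrefl : irreflexive split_adj.
Proof. by move=> [a|a] /=; exact: induced_irrefl. Qed.

Definition split_recomposition : sgraph := SGraph split_sym split_irrefl.
End SplitRecomposition.

(* Main.v *)
Require Import Defs.
From mathcomp Require Import all_boot zify.

(* A word made of k permutations represents G iff the permutations, read as
   linear orders, intersect to a transitive orientation of G. The lower bound
   holds because G and G' are induced subgraphs of G * G'. For the upper bound,
   irreducibility prevents m from being universal, so N(m) contains some b
   adjacent to some c outside N(m) and distinct from m; in a transitive
   orientation of G * G' the edge bc forces all edges from b to N(m') to have the
   same direction. Hence G' has a transitive orientation in which m' is a source,
   and likewise G has one in which m is a sink. Since the number of permutations
   does not depend on the transitive orientation (comparability invariance, proved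
   through Gallai's lemma on 3-colourings without rainbow triangles), G - m and
   G' - m' are realized with these orientations by n = max(k,k') - 1 linear orders
   L_i and L'_i. The n concatenations L_i L'_i, together with one linear order
   V' \ N(m') < N(m) < N(m') < V \ N(m), realize G * G'.

   Linear orders are encoded by injective rank functions into nat. *)

Set Implicit Arguments.
Unset Strict Implicit.
Unset Printing Implicit Defensive.

Lemma connect_closed_pred (T : finType) (e : rel T) (P : T -> Prop) :
  (forall x y, e x y -> P x -> P y) ->
  forall x y, connect e x y -> P x -> P y.
Proof.
move=> eP x y /connectP[p ep ->]; elim: p x ep => //= z p IHp x /andP[xz zp] Px.
by apply: IHp zp _; apply: eP Px.
Qed.

(** * Colourings without rainbow triangles *)

Section GallaiColouring.

Variables (T : finType) (C : eqType) (col : T -> T -> C).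
Hypothesis col_sym : forall x y, col x y = col y x.
Hypothesis no_rainbow : forall x y z, x != y -> x != z -> y != z ->
  col x z != col x y -> col y z != col x y -> col x z = col y z.

Definition mono (S : {set T}) (c : C) : rel T :=
  fun x y => [&& x \in S, y \in S, x != y & col x y == c].

Lemma mono_connect_sym (S : {set T}) c : connect_sym (mono S c).
Proof.
apply: sym_connect_sym => x y; rewrite /mono col_sym eq_sym.
by rewrite andbA [(x \in S) && _]andbC -andbA.
Qed.

Lemma mono_connect_in (S : {set T}) c x y : x \in S -> connect (mono S c) x y -> y \in S.
Proof.
move=> xS xy; apply: (connect_closed_pred (P := fun z => z \in S)) xy xS.
by move=> u v /and4P[].
Qed.

(** Along a [c]-coloured pair [x y] of the component, neither [x w] nor [y w] has colour [c], as [w]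
    lies outside; without rainbow triangles these two colours coincide. *)
Lemma mono_component_homogeneous (S : {set T}) c a b w :
  a \in S -> w \in S -> connect (mono S c) a b -> ~~ connect (mono S c) a w ->
  col w b = col w a.
Proof.
move=> aS wS ab naw.
suff [] : connect (mono S c) a b /\ col w b = col w a by [].
apply: (connect_closed_pred
  (P := fun z => connect (mono S c) a z /\ col w z = col w a)) ab _ => //.
move=> x y xy [ax <-]; have ay := connect_trans ax (connect1 xy).
split=> //; case/and4P: xy => xS yS xNy /eqP cxy.
have out z : z \in S -> connect (mono S c) a z -> z != w /\ col z w != c.
  move=> zS az; have zNw : z != w by apply: contraNneq naw => <-.
  split=> //; apply: contra naw => czw; apply: connect_trans az _.
  by apply: connect1; rewrite /mono zS wS zNw.
have [xNw cxw] := out x xS ax; have [yNw cyw] := out y yS ay.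
by rewrite col_sym [RHS]col_sym; apply/esym/no_rainbow => //; rewrite cxy.
Qed.

(* Deleting a vertex [x] disconnects some colour [c] by induction; since [x]
   has a [c]-neighbour in every [c]-component, an edge of another colour from
   [x] to a component [K] imposes its colour on all edges leaving [K], so [x]
   cannot see both remaining colours. *)
Lemma gallai_disconnected_colour (c1 c2 c3 : C) (S : {set T}) :
  uniq [:: c1; c2; c3] -> 1 < #|S| ->
  exists2 c, c \in [:: c1; c2; c3] &
    exists x y, [/\ x \in S, y \in S & ~~ connect (mono S c) x y].
Proof.
move=> uc; have [n] := ubnP #|S|; elim: n S => // n IHn S /ltnSE leSn S_gt1.
pose disc (X : {set T}) c :=
  [exists x in X, exists y in X, ~~ connect (mono X c) x y].
have discP X : (has (disc X) [:: c1; c2; c3]) -> exists2 c, c \in [:: c1; c2; c3] &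
    exists x y, [/\ x \in X, y \in X & ~~ connect (mono X c) x y].
  case/hasP=> c cc /existsP[x /andP[xX /existsP[y /andP[yX xy]]]].
  by exists c => //; exists x, y.
apply: discP; apply: contraT => /hasPn conn.
have {}conn c x y : c \in [:: c1; c2; c3] -> x \in S -> y \in S ->
    connect (mono S c) x y.
  move=> cc xS yS; apply: contraT => nxy; case/negP: (conn c cc).
  by apply/existsP; exists x; rewrite xS; apply/existsP; exists y; rewrite yS.
have [x [w [xS wS xNw]]] : exists x w, [/\ x \in S, w \in S & x != w].
  by case/card_gt1P: S_gt1 => x [w []]; exists x, w.
have nb c : c \in [:: c1; c2; c3] ->
    exists2 v, v \in S :\ x & col x v = c.
  move=> cc; case/connectP: (conn c x w cc xS wS) => [[|v p] /= + ew].
    by rewrite ew eqxx in xNw.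
  case/andP=> /and4P[_ vS xNv /eqP cxv] _; exists v => //.
  by rewrite !inE eq_sym xNv.
have S'_gt1 : 1 < #|S :\ x|.
  have [v1 v1S e1] := nb c1 (mem_head _ _).
  have [v2 v2S e2] : exists2 v, v \in S :\ x & col x v = c2.
    by apply: nb; rewrite !inE eqxx orbT.
  apply/card_gt1P; exists v1, v2; split=> //; apply: contraTneq uc => v12.
  by rewrite -e1 -e2 v12 /= !inE eqxx.
have S'_lt : #|S :\ x| < n by move: leSn; rewrite (cardsD1 x S) xS.
have [c cc [p [q [pS qS npq]]]] := IHn _ S'_lt S'_gt1.
have seen z : z \in S :\ x ->
    exists2 y, connect (mono (S :\ x) c) z y & y \in S :\ x /\ col x y = c.
  move=> zS; have zSS : z \in S by case/setD1P: zS.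
  have zNx : ~ connect (mono (S :\ x) c) z x.
    by move/(mono_connect_in zS); rewrite !inE eqxx.
  (* Invariant along a [c]-path from [z] to [x]: a [c]-neighbour of [x] has been met in the
     component of [z], or the path is still in that component. *)
  pose seenb t := (exists2 y, connect (mono (S :\ x) c) z y &
      y \in S :\ x /\ col x y = c) \/ connect (mono (S :\ x) c) z t.
  suff : seenb x by case.
  apply: (connect_closed_pred (P := seenb)) (conn c z x cc zSS xS) _; last by right.
  move=> a b /and4P[aS bS aNb /eqP cab] [|za]; first by left.
  have aS' := mono_connect_in zS za.
  have [bx|bNx] := eqVneq b x.
    by left; exists a => //; split=> //; rewrite col_sym -bx.
  right; apply: connect_trans za (connect1 _).
  by rewrite /mono aS' aNb !inE bNx bS cab eqxx.
have forced v y : v \in S :\ x -> y \in S :\ x -> ~~ connect (mono (S :\ x) c) v y ->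
    col x v != c -> col x y = c -> col v y = col x v.
  move=> vS yS nvy cv cy; have vNy : v != y by apply: contraNneq nvy => ->.
  have [vNx yNx] : v != x /\ y != x by case/setD1P: vS; case/setD1P: yS.
  rewrite (col_sym v); apply/esym; apply: (@no_rainbow x y v).
  - by rewrite eq_sym.
  - by rewrite eq_sym.
  - by rewrite eq_sym.
  - by rewrite cy.
  apply: contra nvy => /eqP cyv; apply: connect1.
  by rewrite /mono vS yS vNy col_sym cyv cy eqxx.
have cross v u : v \in S :\ x -> u \in S :\ x -> col x v != c -> col x u != c ->
    col x v = col x u.
  move=> vS uS cv cu; have [vu|nvu] := boolP (connect (mono (S :\ x) c) v u).
    (* Same component: compare both through a [c]-neighbour [y] of [x] in another component. *)
    have [t tS nvt] : exists2 t, t \in S :\ x & ~~ connect (mono (S :\ x) c) v t.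
      have [vp|] := boolP (connect (mono (S :\ x) c) v p); last by exists p.
      exists q => //; apply: contra npq; apply: connect_trans.
      by rewrite mono_connect_sym.
    have [y ty [yS cy]] := seen t tS.
    have nvy : ~~ connect (mono (S :\ x) c) v y.
      apply: contra nvt => vy; apply: connect_trans vy _.
      by rewrite mono_connect_sym.
    have nuy : ~~ connect (mono (S :\ x) c) u y.
      by apply: contra nvy; apply: connect_trans.
    rewrite -(forced v y) // -(forced u y) //.
    rewrite col_sym [RHS]col_sym.
    by rewrite (mono_component_homogeneous vS yS vu).
  have nuv : ~~ connect (mono (S :\ x) c) u v by rewrite mono_connect_sym.
  (* Different components: the pairs [x v], [v z], [v u], [u y], [x u] successively share their
     colour. *)
  have [y vy [yS cy]] := seen v vS; have [z uz [zS cz]] := seen u uS.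
  rewrite -(forced v z) //; last first.
    apply: contra nvu => vz; apply: connect_trans vz _.
    by rewrite mono_connect_sym.
  rewrite -(forced u y) //; last first.
    apply: contra nuv => uy; apply: connect_trans uy _.
    by rewrite mono_connect_sym.
  rewrite (mono_component_homogeneous uS vS uz) //.
  by rewrite (mono_component_homogeneous vS uS vy) // col_sym.
have two c' c'' : c' \in [:: c1; c2; c3] -> c'' \in [:: c1; c2; c3] ->
    c' != c -> c'' != c -> c' = c''.
  move=> cc' cc'' n' n''; have [v vS ev] := nb c' cc'; have [u uS eu] := nb c'' cc''.
  by rewrite -ev -eu; apply: cross; rewrite ?ev ?eu.
move: uc; rewrite /= !inE !andbT negb_or => /andP[/andP[n12 n13] n23].
have [e1|m1] := eqVneq c1 c.
  by case/eqP: n23; apply: two; rewrite ?inE ?eqxx ?orbT // -e1 eq_sym.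
have [e2|m2] := eqVneq c2 c.
  by case/eqP: n13; apply: two; rewrite ?inE ?eqxx ?orbT // -e2 eq_sym.
by case/eqP: n12; apply: two; rewrite ?inE ?eqxx ?orbT.
Qed.

End GallaiColouring.

(** * Intersections of linear orders given by ranks *)

Definition before (T : Type) k (f : nat -> T -> nat) : rel T :=
  fun x y => [forall i : 'I_k, f i x < f i y].

Lemma eq_before (T T' : Type) k (f : nat -> T -> nat) (f' : nat -> T' -> nat) x y x' y' :
  (forall i, i < k -> (f i x < f i y) = (f' i x' < f' i y')) ->
  before k f x y = before k f' x' y'.
Proof. by move=> ff'; apply: eq_forallb => i; apply: ff'. Qed.

Section Realizers.

Variable T : finType.
Implicit Types (S M : {set T}) (r : rel T) (f : nat -> T -> nat).

Definition realizable S k r : Prop :=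
  exists f, (forall i, {in S &, injective (f i)}) /\
            {in S &, forall x y, r x y = before k f x y}.

Lemma before_irr k f x : 0 < k -> before k f x x = false.
Proof. by move=> k0; apply/forallP => /(_ (Ordinal k0)); rewrite ltnn. Qed.

Lemma before_trans k f : transitive (before k f).
Proof.
move=> y x z /forallP xy /forallP yz; apply/forallP => i.
exact: ltn_trans (xy i) (yz i).
Qed.

Lemma realizable_sub S M k r : M \subset S -> realizable S k r -> realizable M k r.
Proof.
move=> /subsetP MS [f [finj fr]]; exists f; split.
  by move=> i x y xM yM; apply: finj; apply: MS.
by move=> x y xM yM; apply: fr; apply: MS.
Qed.

(** Repeating the last order does not change the intersection; [minn i k.-1] caps the index. *)
Lemma realizable_pad S k n r : 0 < k -> k <= n -> realizable S k r -> realizable S n r.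
Proof.
move=> k0 kn [f [finj fr]]; exists (fun i => f (minn i k.-1)); split=> [i|x y xS yS].
  exact: finj.
rewrite fr //; apply/forallP/forallP => H i.
  have ik : minn i k.-1 < k by lia.
  exact: (H (Ordinal ik)).
have ik : i < n by apply: leq_trans kn.
have ei : minn i k.-1 = i by case: i {H ik} => /= i; lia.
by move: (H (Ordinal ik)) => /=; rewrite ei.
Qed.

Lemma realizable_rev S k r : realizable S k r -> realizable S k (fun x y => r y x).
Proof.
case=> f [finj fr]; pose N i := \max_x f i x.
have fN i x : f i x <= N i by apply: leq_bigmax.
exists (fun i x => N i - f i x); split=> [i x y xS yS e|x y xS yS].
  by apply: (finj i) => //; move: e (fN i x) (fN i y); lia.
rewrite fr //; apply: eq_before => i _.
by move: (fN i x) (fN i y); lia.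
Qed.

(** A single order, used [k] times, suffices: rank each point by its number of predecessors in
    [S]. *)
Lemma realizable_total S k r : 0 < k -> irreflexive r -> transitive r ->
  {in S &, forall x y, x != y -> r x y || r y x} -> realizable S k r.
Proof.
move=> k0 rirr rtr rtot; pose f x := #|[set z in S | r z x]|.
have mono_f x y : x \in S -> r x y -> f x < f y.
  move=> xS xy; apply: proper_card; apply/properP; split.
    by apply/subsetP=> z; rewrite !inE => /andP[-> zx]; apply: rtr zx xy.
  by exists x; rewrite !inE xS ?xy // rirr.
exists (fun=> f); split=> [_ x y xS yS fxy|x y xS yS].
  have [//|xy] := eqVneq x y.
  by case/orP: (rtot _ _ xS yS xy) => /mono_f; rewrite fxy ltnn; [move/(_ xS)|move/(_ yS)].
have -> : before k (fun=> f) x y = (f x < f y).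
  by apply/forallP/idP => // /(_ (Ordinal k0)).
have [->|xy] := eqVneq x y; first by rewrite rirr ltnn.
apply/idP/idP => [|lt]; first exact: mono_f.
by case/orP: (rtot _ _ xS yS xy) => // /(mono_f _ _ yS); rewrite ltnNge ltnW.
Qed.

Lemma ltn_lex N a b u v : u < N -> v < N -> a != b ->
  (a * N + u < b * N + v) = (a < b).
Proof.
move=> uN vN; case: (ltngtP a b) => // ab _.
  apply: leq_trans (leq_addr _ _); apply: leq_trans (leq_mul ab (leqnn N)).
  by rewrite mulSn addnC ltn_add2r.
apply/negbTE; rewrite -leqNgt ltnW //.
apply: leq_trans (leq_addr _ _); apply: leq_trans (leq_mul ab (leqnn N)).
by rewrite mulSn addnC ltn_add2r.
Qed.

(** [M] is a module and [c] stands for it in the quotient; each order of [M] is inserted at [c] into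
    the matching order of the quotient. *)
Lemma realizable_subst S M c k r : M \subset S -> c \in M ->
  {in S :\: M & M, forall y a, r y a = r y c /\ r a y = r c y} ->
  realizable M k r -> realizable (c |: (S :\: M)) k r -> realizable S k r.
Proof.
move=> MS cM unif [f [finj fr]] [g [ginj gr]].
pose h x := if x \in M then c else x.
pose N i := (\max_x f i x).+1; pose u i x := if x \in M then f i x else 0.
have uN i x : u i x < N i by rewrite /u /N; case: ifP => // _; rewrite ltnS leq_bigmax.
have hQ x : x \in S -> h x \in c |: (S :\: M).
  by move=> xS; rewrite /h !inE; case: ifP => [|->]; rewrite ?eqxx ?xS ?orbT.
have rh x y : x \in S -> y \in S -> h x != h y -> r x y = r (h x) (h y).
  move=> xS yS; rewrite /h; case: ifP => xM; case: ifP => yM //; rewrite ?eqxx // => _.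
    by apply: (unif y x _ xM).2; rewrite inE yM.
  by apply: (unif x y _ yM).1; rewrite inE xM.
have hM x y : x \in S -> y \in S -> h x = h y -> x != y -> x \in M /\ y \in M.
  rewrite /h => xS yS; case: ifP => xM; case: ifP => yM // e; rewrite ?e ?eqxx //.
    by rewrite -e cM in yM.
  by rewrite e cM in xM.
(* Lexicographic code: first the place in the quotient, then the place inside [M]. *)
exists (fun i x => g i (h x) * N i + u i x); split=> [i x y xS yS e|x y xS yS].
  have [//|xy] := eqVneq x y; have [hxy|hxy] := eqVneq (h x) (h y).
    have [xM yM] := hM _ _ xS yS hxy xy.
    by apply: (finj i) => //; move: e; rewrite hxy /u xM yM => /addnI.
  have gxy : g i (h x) != g i (h y).
    by apply: contra hxy => /eqP/(ginj i _ _ (hQ _ xS) (hQ _ yS)) ->.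
  have := ltn_lex (uN i x) (uN i y) gxy; rewrite eq_sym in gxy.
  have := ltn_lex (uN i y) (uN i x) gxy; rewrite e ltnn; move: gxy.
  by case: ltngtP.
have [<-|xy] := eqVneq x y.
  have [xM|xM] := boolP (x \in M).
    by rewrite fr //; apply: eq_before => i _; rewrite !ltnn.
  have xQ : x \in c |: (S :\: M) by rewrite !inE xM xS orbT.
  by rewrite gr //; apply: eq_before => i _; rewrite !ltnn.
have [hxy|hxy] := eqVneq (h x) (h y).
  have [xM yM] := hM _ _ xS yS hxy xy.
  by rewrite fr //; apply: eq_before => i _; rewrite hxy /u xM yM ltn_add2l.
rewrite rh // gr ?hQ //; apply: eq_before => i _; rewrite ltn_lex //.
by apply: contra hxy => /eqP/(ginj i _ _ (hQ _ xS) (hQ _ yS)) ->.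
Qed.

End Realizers.

(** * Comparability invariance *)

Section Invariance.

Variables (T : finType) (k : nat) (r0 r : rel T).
Hypotheses (k_gt0 : 0 < k) (r0_irr : irreflexive r0) (r_irr : irreflexive r).
Hypotheses (r0_trans : transitive r0) (r_trans : transitive r).
Hypothesis same_graph : forall x y, r0 x y || r0 y x = r x y || r y x.

Let edge x y := r x y || r y x.

Definition agreement x y : option bool :=
  if edge x y then Some (r0 x y == r x y) else None.

Let r_asym x y : r x y -> r y x = false.
Proof. by move=> xy; apply/negP => /(r_trans xy); rewrite r_irr. Qed.

Let r0_asym x y : r0 x y -> r0 y x = false.
Proof. by move=> xy; apply/negP => /(r0_trans xy); rewrite r0_irr. Qed.

Lemma agreement_sym x y : agreement x y = agreement y x.
Proof.
rewrite /agreement /edge [r y x || _]orbC; case: ifP => // e.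
have := same_graph x y; rewrite e => e0; congr Some.
case/orP: e => /[dup] /r_asym -> ->; case/orP: e0 => /[dup] /r0_asym -> -> //.
Qed.

(** If one of the two edges entered [z] and the other left it, transitivity would join [x] and
    [y]. *)
Lemma forced_orientation (q : rel T) x y z : transitive q ->
  ~~ (q x y || q y x) -> q x z || q z x -> q y z || q z y -> q x z = q y z.
Proof.
move=> qtr; rewrite negb_or => /andP[nxy nyx].
have [xz|nxz] /= := boolP (q x z); have [yz|nyz] //= := boolP (q y z).
  by move=> _ zy; rewrite (qtr _ _ _ xz zy) in nxy.
by move=> zx; rewrite (qtr _ _ _ yz zx) in nyx.
Qed.

Lemma agreement_forced x y z :
  ~~ edge x y -> edge x z -> edge y z -> agreement x z = agreement y z.
Proof.
move=> nxy xz yz; rewrite /agreement xz yz.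
rewrite (forced_orientation r_trans nxy xz yz).
by rewrite (forced_orientation r0_trans (x := x) (y := y)) ?same_graph.
Qed.

(** Three edges have only two colours available, two non-edges share theirs, and with exactly one
    non-edge forcing equates the other two colours. *)
Lemma agreement_no_rainbow x y z : x != y -> x != z -> y != z ->
  agreement x z != agreement x y -> agreement y z != agreement x y ->
  agreement x z = agreement y z.
Proof.
move=> _ _ _; have edge_sym u v : edge u v = edge v u by rewrite /edge orbC.
have agN u v : ~~ edge u v -> agreement u v = None by rewrite /agreement => /negbTE->.
have [xy|nxy] := boolP (edge x y); last first.
  rewrite (agN _ _ nxy).
  have [xz|/agN->//] := boolP (edge x z); have [yz|/agN->//] := boolP (edge y z).
  by move=> _ _; apply: agreement_forced.
have [xz|nxz] := boolP (edge x z); have [yz|nyz] := boolP (edge y z).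
- rewrite /agreement xy xz yz.
  by case: (r0 x y == _); case: (r0 x z == _); case: (r0 y z == _).
- by rewrite (agreement_sym x z) (agreement_forced (x := z) (y := y)) ?eqxx //
    1?edge_sym // (agreement_sym y x) eqxx.
- by rewrite (agreement_sym y z) (agreement_forced (x := z) (y := x)) ?eqxx //
    1?edge_sym // edge_sym.
- by rewrite (agN _ _ nxz) (agN _ _ nyz).
Qed.

(** Here [r] has the chain [b], [y], [a]. Since both edges at [y] have the same agreement, [r0] has
    this chain or its reverse, and transitivity gives [a b] that agreement too. *)
Lemma agreement_edge_not_between a b y :
  agreement a b != agreement y a -> agreement y a = agreement y b ->
  r y a -> r b y -> False.
Proof.
move=> nab yab ya yb; have ba := r_trans yb ya.
have exy : edge y a by rewrite /edge ya.
have eyb : edge y b by rewrite /edge yb orbT.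
have eba : edge b a by rewrite /edge ba.
move: nab yab; rewrite agreement_sym (agreement_sym y b) /agreement exy eba.
rewrite /edge yb orTb ya ba => nab [e].
have [r0ya|nya] := boolP (r0 y a).
  have r0by : r0 b y by move: e; rewrite r0ya; case: (r0 b y).
  by move: nab; rewrite r0ya (r0_trans r0by r0ya).
have r0ay : r0 a y.
  by have := same_graph y a; rewrite ya (negbTE nya).
have nby : ~~ r0 b y by move: e; rewrite (negbTE nya); case: (r0 b y).
have r0yb : r0 y b by have := same_graph b y; rewrite yb (negbTE nby).
by move: nab; rewrite (negbTE nya) (r0_asym (r0_trans r0ay r0yb)).
Qed.

(** Equal colours make [y a] and [y b] both edges or both non-edges; edges of opposite direction
    would put [y] between [a] and [b]. *)
Lemma agreement_edge_uniform a b y :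
  agreement a b != agreement y a -> agreement y a = agreement y b ->
  r y a = r y b /\ r a y = r b y.
Proof.
move=> nab yab; have nba : agreement b a != agreement y b by rewrite agreement_sym -yab.
have n1 := agreement_edge_not_between nab yab.
have n2 := agreement_edge_not_between nba (esym yab).
have : edge y a = edge y b.
  by move: yab; rewrite /agreement; do 2!case: ifP.
have a1 := @r_asym y a; have a2 := @r_asym y b.
rewrite /edge; case: (r y a) (r y b) (r a y) (r b y) n1 n2 a1 a2 => [] [] [] [] //= n1 n2 a1 a2 _;
  do ?[by case: n1|by case: n2|by have := a1 isT|by have := a2 isT].
Qed.

(* Colour pairs as non-edge, agreeing edge or disagreeing edge. If a colour is
   absent on [S], then [r] is [r0], its reverse, or a linear order. Otherwise
   some colour has a nontrivial component properly contained in [S], to which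
   [r] relates every outside vertex uniformly, and induction applies to that
   component and to the quotient. *)
Lemma realizable_invariant (S : {set T}) : realizable S k r0 -> realizable S k r.
Proof.
have [n] := ubnP #|S|; elim: n S => // n IHn S /ltnSE leSn RS.
have agsym := agreement_sym; have agrb := agreement_no_rainbow.
pose used c := [exists a in S, exists b in S, (a != b) && (agreement a b == c)].
have usedP c a b : ~~ used c -> a \in S -> b \in S -> a != b -> agreement a b != c.
  move=> nc aS bS ab; apply: contra nc => agc; apply/existsP; exists a; rewrite aS.
  by apply/existsP; exists b; rewrite bS ab.
have r0b : {in S &, forall x y, x != y -> edge x y -> r0 x y = r x y} -> realizable S k r.
  move=> H; case: RS => f [finj fr]; exists f; split=> // x y xS yS; rewrite -fr //.
  have [->|xy] := eqVneq x y; first by rewrite r_irr r0_irr.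
  have [|] := boolP (edge x y); first by move/H->.
  move=> ne; have := same_graph x y; move: ne; rewrite /edge.
  by case: (r x y) (r y x) (r0 x y) => [] [] [].
have [u1|/usedP n1] := boolP (used (Some false)); last first.
  apply: r0b => x y xS yS xy exy; have := n1 _ _ xS yS xy.
  by rewrite /agreement exy; case: (r0 x y =P r x y).
have [u2|/usedP n2] := boolP (used (Some true)); last first.
  suff: realizable S k (fun x y => r0 y x).
    case=> f [finj fr]; exists f; split=> // x y xS yS; rewrite -fr //.
    have [->|xy] := eqVneq x y; first by rewrite r_irr r0_irr.
    have := same_graph x y; have := n2 _ _ xS yS xy; rewrite /agreement /edge.
    have := @r_asym x y; have := @r0_asym x y.
    case: (r x y) (r y x) (r0 x y) (r0 y x) => [] [] [] [] //=; do ?[by move/(_ isT)|by move=> _ /(_ isT)].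
  exact: realizable_rev.
have [u3|/usedP n3] := boolP (used None); last first.
  apply: realizable_total => // x y xS yS xy.
  by have := n3 _ _ xS yS xy; rewrite /agreement /edge; case: ifP.
have S_gt1 : 1 < #|S|.
  case/existsP: u3 => a /andP[aS /existsP[b /and3P[bS ab _]]].
  by apply/card_gt1P; exists a, b.
have [c cc [x [y [xS yS nxy]]]] : exists2 c, c \in [:: Some false; Some true; None] &
    exists x y, [/\ x \in S, y \in S & ~~ connect (mono agreement S c) x y].
  exact: gallai_disconnected_colour.
have {cc} : used c by move: cc; rewrite !inE => /or3P[] /eqP->.
case/existsP=> a /andP[aS /existsP[b /and3P[bS ab /eqP agab]]].
(* This component is nontrivial because [a b] has colour [c], and proper because [c] is disconnected
   on [S]. *)
pose M := [set z in S | connect (mono agreement S c) a z].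
have aM : a \in M by rewrite inE aS connect0.
have csym := mono_connect_sym agsym.
have bM : b \in M by rewrite inE bS connect1 // /mono aS bS ab agab eqxx.
have MS : M \subset S by apply/subsetP=> z; rewrite inE => /andP[].
have [t tS tM] : exists2 t, t \in S & t \notin M.
  have [xM|] := boolP (x \in M); last by exists x.
  exists y => //; apply: contra nxy; rewrite !inE in xM * => /andP[_].
  by case/andP: xM => _; rewrite csym; apply: connect_trans.
have Mlt : #|M| < n.
  by apply: leq_trans leSn; apply: proper_card; apply/properP; split=> //; exists t.
have Qlt : #|a |: (S :\: M)| < n.
  apply: leq_trans leSn; apply: proper_card; apply/properP; split.
    by apply/subsetP=> z; rewrite !inE => /orP[/eqP->|/andP[]].
  by exists b => //; rewrite !inE eq_sym (negbTE ab) (andbC _ (b \in S)) bS /= in bM *; rewrite bM.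
apply: (realizable_subst MS aM _ (IHn M Mlt (realizable_sub MS RS))); last first.
  apply: IHn => //; apply: realizable_sub RS.
  by apply/subsetP=> z; rewrite !inE => /orP[/eqP->|/andP[]].
move=> z w /setDP[zS zM]; rewrite inE => /andP[wS aw].
have nz v : connect (mono agreement S c) a v -> z != v /\ agreement z v != c.
  move=> av; have vS := mono_connect_in aS av.
  have zv : z != v by apply: contraNneq zM => ->; rewrite inE vS.
  split=> //; apply: contra zM => /eqP agzv; rewrite inE zS.
  apply: connect_trans av (connect1 _).
  by rewrite /mono vS zS eq_sym zv agsym agzv eqxx.
(* Uniformity spreads along [c]-paths: [z] is outside, so [z u] and [z v] avoid [c] and have equal
   colours. *)
pose P v := connect (mono agreement S c) a v /\ (r z v = r z a /\ r v z = r a z).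
suff [] : P w by [].
apply: (connect_closed_pred (P := P)) aw _ => // u v uv [au [e1 e2]].
have av := connect_trans au (connect1 uv); split=> //; rewrite -e1 -e2.
case/and4P: uv => uS vS neq_uv /eqP aguv.
have [zu agzu] := nz u au; have [zv agzv] := nz v av.
have agzuv : agreement z u = agreement z v.
  have [uz vz] : u != z /\ v != z by rewrite ![_ == z]eq_sym.
  by rewrite ![agreement z _]agsym; apply: agrb; rewrite // aguv agsym.
have nuv : agreement u v != agreement z u by rewrite aguv eq_sym.
by have [-> ->] := agreement_edge_uniform nuv agzuv.
Qed.

End Invariance.

(** * Words made of permutations, and linear orders *)

Section Words.

Variable G : sgraph.

Lemma filter_pred2_uniq (T : eqType) (x y : T) p :
  uniq p -> x \in p -> y \in p -> x != y ->
  [seq z <- p | pred2 x y z] = if index x p < index y p then [:: x; y] else [:: y; x].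
Proof.
move=> + + + xy; elim: p => //= a p IHp /andP[ap up]; rewrite !inE ![a == _]eq_sym.
have filter1 z t : z \in p -> t \notin p ->
    [seq w <- p | pred2 t z w] = [:: z] /\ [seq w <- p | pred2 z t w] = [:: z].
  move=> zp tp; rewrite -(filter_pred1_uniq up zp).
  split; apply: eq_in_filter => w wp /=; rewrite [w == t](negbTE _) ?orbF //;
    by apply: contraNneq tp => <-.
have [xa|xa] := eqVneq x a; have [ya|ya] := eqVneq y a => //=.
- by case/eqP: xy; rewrite xa ya.
- by move=> _ yp; rewrite (filter1 y x yp _).1 xa.
- by move=> xp _; rewrite (filter1 x y xp _).2 ya.
- by move=> xp yp; rewrite IHp.
Qed.

(** Each permutation contributes a block [xy] or [yx]; the word of blocks alternates exactly when
    all blocks are equal. *)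
Lemma alternate_flatten (ps : seq (seq G)) x y :
  x != y -> (forall p, p \in ps -> perm_eq p (enum G)) ->
  alternate x y (flatten ps) =
    all (fun p => index x p < index y p) ps || all (fun p => index y p < index x p) ps.
Proof.
move=> xy psP; rewrite /alternate filter_flatten.
pose e p := index x p < index y p; pose w b := if b then [:: x; y] else [:: y; x].
have -> : [seq [seq z <- p | pred2 x y z] | p <- ps] = [seq w b | b <- map e ps].
  rewrite -map_comp; apply/eq_in_map => p /psP pe.
  have pG z : z \in p by rewrite (perm_mem pe) mem_enum.
  by rewrite filter_pred2_uniq ?pG // (perm_uniq pe) enum_uniq.
have -> : all (fun p => index y p < index x p) ps = all negb (map e ps).
  rewrite all_map; apply: eq_in_all => p /psP pe /=; rewrite /e -leqNgt [RHS]leq_eqVlt.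
  have xp : x \in p by rewrite (perm_mem pe) mem_enum.
  have [/(congr1 (nth x p))|//] := eqVneq (index y p) (index x p).
  rewrite !nth_index // ?(perm_mem pe) ?mem_enum // => yx.
  by rewrite yx eqxx in xy.
have -> : all (fun p => index x p < index y p) ps = all id (map e ps) by rewrite all_map.
have step bs : path (fun a b => a != b) y (flatten (map w bs)) = all id bs /\
               path (fun a b => a != b) x (flatten (map w bs)) = all negb bs.
  by elim: bs => // -[] bs [IHy IHx]; rewrite /w /= ?IHy ?IHx ?eqxx ?xy ?(eq_sym y x) ?xy.
case: (map e ps) => // -[] bs; have [IHy IHx] := step bs.
  by rewrite /w /= IHy xy orbF.
by rewrite /w /= IHx eq_sym xy.
Qed.

Lemma perm_representable_gt0 (x : G) k : perm_representable G k -> 0 < k.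
Proof. by case=> -[|p ps] [<- _ [/(_ x)]]. Qed.

Lemma perm_representable_realizable k : 0 < k -> perm_representable G k ->
  exists2 r : rel G, realizable [set: G] k r &
    [/\ irreflexive r, transitive r & forall x y, adj x y = r x y || r y x].
Proof.
move=> k0 [ps [psk psP [_ psadj]]]; pose f i x := index x (nth [::] ps i).
have fE x y : before k f x y = all (fun p => index x p < index y p) ps.
  apply/forallP/(all_nthP [::]) => [H i|H i]; last by apply: H; rewrite psk.
  by rewrite psk => ik; apply: (H (Ordinal ik)).
exists (before k f).
  (* [realizable] asks for injectivity at every index, so [enum_rank] fills the indices from [k]
     on. *)
  exists (fun i => if i < k then f i else fun x => enum_rank x : nat); split=> [i x y _ _|x y _ _].
    case: ifP => [ik|_]; last by move/val_inj/enum_rank_inj.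
    rewrite /f; have /psP pe : nth [::] ps i \in ps by rewrite mem_nth ?psk.
    move/(congr1 (nth x (nth [::] ps i))).
    by rewrite !nth_index // (perm_mem pe) mem_enum.
  by apply: eq_before => i ->.
split=> [x||x y]; [exact: before_irr|exact: before_trans|].
have [->|xy] := eqVneq x y; first by rewrite adj_irrefl before_irr.
by rewrite psadj // alternate_flatten // !fE.
Qed.

Lemma index_sort_rank (f : G -> nat) x y : injective f ->
  let p := sort (fun a b => f a <= f b) (enum G) in
  (index x p < index y p) = (f x < f y).
Proof.
move=> finj p; have pG z : z \in p by rewrite mem_sort mem_enum.
have tr : transitive (fun a b => f a <= f b) by move=> a b c; apply: leq_trans.
have srt : sorted (fun a b => f a <= f b) p.
  by apply: sort_sorted => a b; apply: leq_total.
have lt u v : index u p < index v p -> f u < f v.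
  move=> uv; rewrite ltn_neqAle (sorted_ltn_index tr srt) // andbT.
  by apply: contraTneq uv => /finj->; rewrite ltnn.
apply/idP/idP => [|fxy]; first exact: lt.
case: (ltngtP (index x p) (index y p)) => // [/lt|].
  by rewrite ltnNge ltnW.
move/(congr1 (nth x p)); rewrite !nth_index // => exy.
by rewrite exy ltnn in fxy.
Qed.

Lemma realizable_perm_representable k (r : rel G) :
  0 < k -> (forall x y, adj x y = r x y || r y x) ->
  realizable [set: G] k r -> perm_representable G k.
Proof.
move=> k0 radj [f [finj fr]].
have {}finj i : injective (f i) by move=> x y; apply: finj.
pose p i := sort (fun a b => f i a <= f i b) (enum G).
have psP q : q \in mkseq p k -> perm_eq q (enum G).
  by case/mapP=> i _ ->; rewrite perm_sort.
have allE x y : all (fun q => index x q < index y q) (mkseq p k) = r x y.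
  rewrite fr // all_map; apply/allP/forallP => [H i|H i].
    by rewrite -(index_sort_rank x y (finj i)); apply: H; rewrite mem_iota /=.
  by rewrite mem_iota /= => ik; rewrite index_sort_rank //; apply: (H (Ordinal ik)).
exists (mkseq p k); split=> //; first exact: size_mkseq.
split=> [x|x y xy]; last by rewrite alternate_flatten // !allE.
apply/flattenP; exists (p 0); last by rewrite mem_sort mem_enum.
by apply/mapP; exists 0; rewrite // mem_iota.
Qed.

End Words.

Lemma perm_representable_embed (G H : sgraph) (h : G -> H) k (x : G) :
  injective h -> (forall x y, adj (h x) (h y) = adj x y) ->
  perm_representable H k -> perm_representable G k.
Proof.
move=> hinj hadj Hk; have k0 := perm_representable_gt0 (h x) Hk.
have [r [f [finj fr]] [_ _ radj]] := perm_representable_realizable k0 Hk.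
apply: (@realizable_perm_representable _ _ (fun x y => r (h x) (h y))) => //.
  by move=> y z; rewrite -hadj radj.
exists (fun i y => f i (h y)); split=> [i y z _ _ /finj e|y z _ _].
  by apply/hinj/e.
by rewrite fr.
Qed.

(** This frees the choice of orientation: gluing needs prescribed behaviour at [m] and [m'], which
    the given words need not show. *)
Lemma perm_representable_orientation (G : sgraph) k (r : rel G) :
  0 < k -> irreflexive r -> transitive r ->
  (forall x y, adj x y = r x y || r y x) ->
  perm_representable G k -> realizable [set: G] k r.
Proof.
move=> k0 rirr rtr radj Gk.
have [r0 r0k [r0irr r0tr r0adj]] := perm_representable_realizable k0 Gk.
by apply: realizable_invariant r0k => // x y; rewrite -r0adj.
Qed.

(* The first linear order is [~A2 < A1 < A2 < ~A1], which puts [T2] before [T1]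
   on every cross pair outside [A1 * A2]; all others put [T1] before [T2]. *)
Lemma realizable_glue (T1 T2 : finType) (A1 : pred T1) (A2 : pred T2)
    (r1 : rel T1) (r2 : rel T2) n :
  0 < n -> (forall x y, r1 x y -> A1 y -> A1 x) -> (forall x y, r2 x y -> A2 x -> A2 y) ->
  realizable [set: T1] n r1 -> realizable [set: T2] n r2 ->
  realizable [set: T1 + T2] n.+1 (fun u v => match u, v with
    | inl x, inl y => r1 x y | inr x, inr y => r2 x y
    | inl x, inr y => A1 x && A2 y | inr _, inl _ => false end).
Proof.
move=> n0 A1down A2up [f [finj fr]] [g [ginj gr]].
pose N i := (\max_x f i x + \max_x g i x).+1.
have fN i x : f i x < N i by rewrite ltnS; apply: leq_trans (leq_addr _ _); apply: leq_bigmax.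
have gN i x : g i x < N i by rewrite ltnS; apply: leq_trans (leq_addl _ _); apply: leq_bigmax.
(* [N 0] exceeds all ranks of [f 0] and [g 0], so the four blocks, offset by multiples of [N 0], do
   not overlap. *)
pose F0 (u : T1 + T2) := match u with
  | inl x => if A1 x then N 0 + f 0 x else 3 * N 0 + f 0 x
  | inr y => if A2 y then 2 * N 0 + g 0 y else g 0 y end.
pose F1 i (u : T1 + T2) := match u with inl x => f i x | inr y => N i + g i y end.
pose F i := if i is j.+1 then F1 j else F0.
have FE u v : before n.+1 F u v = (F0 u < F0 v) && before n F1 u v.
  apply/forallP/andP => [H|[H0 /forallP H1] [[|i] ltin]] //.
    split; first exact: (H ord0).
    by apply/forallP => i; apply: (H (lift ord0 i)).
  exact: (H1 (Ordinal (ltin : i < n))).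
exists F; split.
  have fi i x y : f i x = f i y -> x = y by apply: finj.
  have gi i x y : g i x = g i y -> x = y by apply: ginj.
  case=> [|i] [x|x] [y|y] _ _ /=; have := fN; have := gN => gN' fN'.
  - case: ifP; case: ifP => ? ? e; congr inl; apply: (fi 0);
      by move: (fN 0 x) (fN 0 y) e; lia.
  - by case: ifP; case: ifP => ? ?; move: (fN 0 x) (gN 0 y); lia.
  - by case: ifP; case: ifP => ? ?; move: (gN 0 x) (fN 0 y); lia.
  - case: ifP; case: ifP => ? ? e; congr inr; apply: (gi 0);
      by move: (gN 0 x) (gN 0 y) e; lia.
  - by move/fi->.
  - by move: (fN i x); lia.
  - by move: (fN i y); lia.
  - by move/addnI/gi->.
move=> [x|x] [y|y] _ _; rewrite FE.
- have -> : before n F1 (inl x) (inl y) = r1 x y by rewrite fr.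
  case rxy: (r1 x y); rewrite ?andbF // andbT /=.
  have lt0 : f 0 x < f 0 y.
    by move: rxy; rewrite fr // => /forallP/(_ (Ordinal n0)).
  move: (A1down _ _ rxy) (fN 0 x) (fN 0 y).
  by case: (A1 x); case: (A1 y) => Ad lx ly; first [lia | have := Ad isT].
- have -> : before n F1 (inl x) (inr y).
    by apply/forallP => i /=; move: (fN i x); lia.
  rewrite andbT /=; move: (fN 0 x) (gN 0 y).
  by case: ifP; case: ifP => _ _ /=; lia.
- rewrite [before _ _ _ _](negbTE _) ?andbF //.
  apply/negP => /forallP/(_ (Ordinal n0)) /=; move: (fN 0 y); lia.
- have -> : before n F1 (inr x) (inr y) = r2 x y.
    by rewrite gr //; apply: eq_before => i _ /=; rewrite ltn_add2l.
  case rxy: (r2 x y); rewrite ?andbF // andbT /=.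
  have lt0 : g 0 x < g 0 y.
    by move: rxy; rewrite gr // => /forallP/(_ (Ordinal n0)).
  move: (A2up _ _ rxy) (gN 0 x) (gN 0 y).
  by case: (A2 x); case: (A2 y) => Ad lx ly; first [lia | have := Ad isT].
Qed.

(** * Orientations inherited from a host graph *)

Section Extension.

Variables (G H : sgraph) (m : G) (i : induced [set~ m] -> H) (b : H).
Hypothesis i_inj : injective i.
Hypothesis i_adj : forall u v, adj (i u) (i v) = adj u v.
Hypothesis i_b : forall u, i u != b.
Hypothesis adj_i_b : forall u, adj (i u) b = (val u \in nbhd m).

(** The vertex [b] plays the role of [m], which makes [G] an induced subgraph of [H]. *)
Definition extension (x : G) : H :=
  if (insub x : option {x : G | x \in [set~ m]}) is Some u then i u else b.

Variant extension_spec x : H -> Type :=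
  | ExtensionCentre of x = m : extension_spec x b
  | ExtensionOther u of x = val u : extension_spec x (i u).

Lemma extensionP x : extension_spec x (extension x).
Proof.
rewrite /extension; case: insubP => [u _ <-|]; first exact: ExtensionOther.
by rewrite !inE negbK => /eqP; apply: ExtensionCentre.
Qed.

Lemma extension_inj : injective extension.
Proof.
move=> x y; case: extensionP => [->|u ->]; case: extensionP => [->|v ->] //.
- by move/esym/eqP; rewrite (negbTE (i_b _)).
- by move/eqP; rewrite (negbTE (i_b _)).
- by move/i_inj->.
Qed.

Lemma extension_adj x y : adj (extension x) (extension y) = adj x y.
Proof.
case: extensionP => [->|u ->]; case: extensionP => [->|v ->].
- by rewrite !adj_irrefl.
- by rewrite adj_sym adj_i_b inE.
- by rewrite adj_i_b inE adj_sym.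
- exact: i_adj.
Qed.

(* All edges at [b] to the image of [N(m)] are forced to have the same direction
   by the edge [b c]. *)
Lemma sink_orientation (c : H) :
  comparability_graph H -> adj b c ->
  (forall u, val u \in nbhd m -> ~~ adj (i u) c) ->
  exists r : rel G, [/\ irreflexive r, transitive r,
    forall x y, adj x y = r x y || r y x & forall x, r m x = false].
Proof.
case=> r [[radj rasym] rtr] bc nc.
pose q x y := r (extension x) (extension y).
have rirr x : r x x = false by have := rasym x x; rewrite andbb => /negbTE.
have qirr : irreflexive q by move=> x; rewrite /q rirr.
have qtr : transitive q by move=> y x z; apply: rtr.
have qadj x y : adj x y = q x y || q y x by rewrite /q -radj extension_adj.
have em : extension m = b.
  by case: extensionP => // u mu; have := valP u; rewrite -mu !inE eqxx.
have nxc x : adj x m -> ~~ adj (extension x) c.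
  case: extensionP => [->|u ->]; first by rewrite adj_irrefl.
  by rewrite adj_sym => um; apply: nc; rewrite inE.
(* With [c] before [b], an edge from [b] to an image [x] would give the forbidden edge [c x], so [m]
   is a sink. Otherwise [m] is a source, and the orientation is reversed. *)
have [rcb|nrcb] := boolP (r c b).
  exists q; split=> // x; apply/negP; rewrite /q em => bx.
  have /nxc : adj x m by rewrite qadj /q em bx orbT.
  by rewrite radj (rtr _ _ _ rcb bx) orbT.
have rbc : r b c by move: bc; rewrite radj (negbTE nrcb) orbF.
exists (fun x y => q y x); split=> // [y x z yx zy|x y|x].
- exact: qtr zy yx.
- by rewrite qadj orbC.
apply/negP; rewrite /q em => xb.
have /nxc : adj x m by rewrite qadj /q em xb.
by rewrite radj (rtr _ _ _ xb rbc).
Qed.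

End Extension.

(** * Consequences of irreducibility *)

Section Irreducible.

Variables (G : sgraph) (m : G) (k : nat).
Hypotheses (k_ge2 : 1 < k.-1) (Gconn : connected G) (Girr : prn_irreducible k G).

(** A universal [m] could be put first in all [k.-1] orders of [G - m], realizing [G] with too few
    orders. *)
Lemma irreducible_not_universal : exists2 x, x != m & x \notin nbhd m.
Proof.
have [_ _ [_ kmin] /(_ m) [Gm _]] := Girr; have k0 : 0 < k.-1 by apply: ltnW.
case: (pickP [pred x | x != m & x \notin nbhd m]) => [x /andP[]|univ]; first by exists x.
have {}univ x : x != m -> adj m x.
  by move=> xm; have := univ x; rewrite /= xm inE => /negbFE.
suff /kmin : perm_representable G k.-1 by lia.
have [r [f [finj fr]] [rirr rtr radj]] := perm_representable_realizable k0 Gm.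
pose o (x : G) := (insub x : option {x : G | x \in [set~ m]}).
pose q x y := match o x, o y with
  | Some u, Some v => r u v | None, Some _ => true | _, None => false end.
apply: (@realizable_perm_representable _ _ q) => // [x y|].
  rewrite /q /o; case: insubP => [u _ <-|]; case: insubP => [v _ <-|] //.
  - by rewrite -radj.
  - by rewrite !inE negbK => /eqP->; rewrite orbT adj_sym univ //; have := valP u; rewrite !inE.
  - by rewrite !inE negbK => /eqP->; rewrite univ //; have := valP v; rewrite !inE.
  - by rewrite !inE !negbK => /eqP-> /eqP->; rewrite adj_irrefl.
exists (fun i x => if o x is Some u then (f i u).+1 else 0); split=> [i x y _ _|x y _ _].
  rewrite /o; case: insubP => [u _ <-|]; case: insubP => [v _ <-|] //.
    by case=> /finj->.
  by rewrite !inE !negbK => /eqP-> /eqP->.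
rewrite /q /before; case: (o x) (o y) => [u|] [v|].
- by rewrite fr //; apply: eq_before.
- by apply/esym/negP => /forallP/(_ (Ordinal k0)).
- by apply/esym/forallP.
- by apply/esym/negP => /forallP/(_ (Ordinal k0)).
Qed.

(** Otherwise the closed neighbourhood of [m] would be closed under adjacency, hence everything by
    connectedness. *)
Lemma irreducible_exit : exists b c : induced [set~ m],
  [/\ val b \in nbhd m, val c \notin nbhd m & adj b c].
Proof.
have [w wm wN] := irreducible_not_universal.
pose P := [exists b : induced [set~ m], exists c : induced [set~ m],
  [&& val b \in nbhd m, val c \notin nbhd m & adj b c]].
have [/existsP[b /existsP[c /and3P[]]]|nP] := boolP P; first by exists b, c.
have stay x y : adj x y -> x = m \/ x \in nbhd m -> y = m \/ y \in nbhd m.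
  have [->|ym] := eqVneq y m; first by left.
  move=> xy [xm|xN]; first by right; rewrite inE -xm.
  right; apply: contraR nP => yN.
  have xm : x != m by apply: contraTneq xN => ->; rewrite inE adj_irrefl.
  have xI : x \in [set~ m] by rewrite !inE.
  have yI : y \in [set~ m] by rewrite !inE.
  apply/existsP; exists (exist _ x xI); apply/existsP; exists (exist _ y yI).
  by rewrite /= xN yN.
case: (connect_closed_pred stay (Gconn m w)); first by left.
  by move=> e; rewrite e eqxx in wm.
by move=> e; rewrite e in wN.
Qed.

Lemma irreducible_realizable (r : rel G) n : irreflexive r -> transitive r ->
  (forall x y, adj x y = r x y || r y x) -> k.-1 <= n ->
  realizable [set: induced [set~ m]] n (fun x y => r (val x) (val y)).
Proof.
move=> rirr rtr radj kn; have [_ _ _ /(_ m) [Gm _]] := Girr.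
apply: (@realizable_pad _ _ k.-1) => //; first exact: ltnW.
apply: perm_representable_orientation Gm => [|u|v u w|u v]; first exact: ltnW.
- exact: rirr.
- exact: rtr.
- exact: radj.
Qed.

End Irreducible.

(** * The permutation number of a split recomposition *)

Unset Implicit Arguments.

Theorem theorem11 (k k' : nat) (G G' : sgraph) (m : G) (m' : G')
    (hk : 3 <= k) (hk' : 3 <= k')
    (hcG : connected G) (hcG' : connected G')
    (hG : prn_irreducible k G) (hG' : prn_irreducible k' G')
    (hcomp : comparability_graph (split_recomposition m m')) :
  is_prn (split_recomposition m m') (maxn k k').
Proof.
have [k1 k1'] : 1 < k.-1 /\ 1 < k'.-1 by lia.
have [b [c [bN cN bc]]] := irreducible_exit m k1 hcG hG.
have [b' [c' [bN' cN' bc']]] := irreducible_exit m' k1' hcG' hG'.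
pose S := split_recomposition m m'.
pose il (u : induced [set~ m]) : S := inl u.
pose ir (u : induced [set~ m']) : S := inr u.
have il_inj : injective il by move=> u v [].
have ir_inj : injective ir by move=> u v [].
have il_adj u v : adj (il u) (il v) = adj u v by [].
have ir_adj u v : adj (ir u) (ir v) = adj u v by [].
(* As [b'] is in [N(m')], its neighbours on the other side are exactly [N(m)], so it replaces [m];
   likewise [b] replaces [m']. *)
have il_b u : il u != ir b' by [].
have ir_b u : ir u != il b by [].
have adj_il u : adj (il u) (ir b') = (val u \in nbhd m) by rewrite /= bN' andbT.
have adj_ir u : adj (ir u) (il b) = (val u \in nbhd m') by rewrite /= bN.
split; last first.
  move=> j Sj; rewrite geq_max; apply/andP; split.
    have [_ _ [_ kmin] _] := hG; apply: kmin.
    exact: perm_representable_embed m (extension_inj il_inj il_b)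
      (extension_adj il_adj adj_il) Sj.
  have [_ _ [_ kmin] _] := hG'; apply: kmin.
  exact: perm_representable_embed m' (extension_inj ir_inj ir_b)
    (extension_adj ir_adj adj_ir) Sj.
have [r [rirr rtr radj rm]] : exists r : rel G, [/\ irreflexive r, transitive r,
    forall x y, adj x y = r x y || r y x & forall x, r m x = false].
  (* [c'] lies outside [N(m')], so it has no neighbour on the other side. *)
  apply: (sink_orientation il_adj adj_il (c := ir c')) => // u _.
  by rewrite /= (negbTE cN') andbF.
have [q [qirr qtr qadj qm]] : exists r : rel G', [/\ irreflexive r, transitive r,
    forall x y, adj x y = r x y || r y x & forall x, r m' x = false].
  apply: (sink_orientation ir_adj adj_ir (c := il c)) => // u _.
  by rewrite /= (negbTE cN).
(* Gluing adds one order. *)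
pose n := (maxn k k').-1.
have [n0 [kn kn']] : 0 < n /\ k.-1 <= n /\ k'.-1 <= n by rewrite /n; lia.
have rn := irreducible_realizable m k1 hG rirr rtr radj kn.
(* Reversal makes [m'] a source, so that all cross edges can run from [G - m] to [G' - m']. *)
have qn := realizable_rev (irreducible_realizable m' k1' hG' qirr qtr qadj kn').
have -> : maxn k k' = n.+1 by rewrite /n; lia.
pose A1 (u : induced [set~ m]) := val u \in nbhd m.
pose A2 (u : induced [set~ m']) := val u \in nbhd m'.
(* As [m] is a sink, [N(m)] is its set of predecessors. *)
have A1down u v : r (val u) (val v) -> A1 v -> A1 u.
  by rewrite /A1 !inE !radj !rm /=; apply: rtr.
have A2up u v : q (val v) (val u) -> A2 u -> A2 v.
  by rewrite /A2 !inE !qadj !qm /=; apply: qtr.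
have glued := realizable_glue n0 A1down A2up rn qn.
refine (@realizable_perm_representable S _ _ _ _ glued) => //.
move=> [u|u] [v|v]; rewrite ?orbF //.
- exact: radj.
- by rewrite orbC; apply: qadj.
Qed.
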